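(* Let $\rho_1,\dots,\rho_n$ be $m\times m$ density matrices and $(\eta_1,\dots,\eta_n)$ a probability vector with all $\eta_i>0$, and let $\rho$ be the QSD-state of $\{\rho_i,\eta_i\}$ on $\mathcal H_a\otimes\mathcal H_b=\mathbb C^n\otimes\mathbb C^m$. Then $$P^{opt}_E(\{\rho_i,\eta_i\}_{i=1}^n)\le C^a_F(\rho),$$ where $C^a_F$ is taken with respect to the computational basis $\{|i\rangle\}_{i=1}^n$ of $\mathbb C^n$. Equality holds when $\rho_1,\dots,\rho_n$ are linearly independent.
   Context: The QSD-state of $\{\rho_i,\eta_i\}$ is the $mn\times mn$ block matrix with $(i,j)$-th block $\sqrt{\eta_i\rho_i}\sqrt{\eta_j\rho_j}$. Partial incoherent states: $I^a_P=\{\sum_ip_i|i\rangle\langle i|\otimes\sigma_i\}$; $C^a_F(\rho)=\min_{\sigma\in I^a_P}(1-F^2(\rho,\sigma))$ with $F(\rho,\sigma)=\mathrm{Tr}\sqrt{\sqrt\sigma\rho\sqrt\sigma}$. $P^{opt}_E(\{\rho_i,\eta_i\})=1-\max_{\{M_i\}}\sum_i\eta_i\mathrm{Tr}(M_i\rho_i)$, the maximum over all POVMs. States with spectral decompositions $\rho_i=\sum_j\lambda_{ij}|\psi_{ij}\rangle\langle\psi_{ij}|$ ($\lambda_{ij}>0$) are linearly independent if the collection $\{|\psi_{ij}\rangle\}_{i,j}$ is linearly independent. *)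

(* Defs.v *)
From HB Require Import structures.
From mathcomp Require Import all_boot all_order all_algebra.
From Stdlib Require Import ClassicalEpsilon.
Set Implicit Arguments. Unset Strict Implicit. Unset Printing Implicit Defensive.
Import Order.TTheory GRing.Theory Num.Theory.
Local Open Scope ring_scope.

Section QSD.
Variable C : numClosedFieldType.

Definition adjmx p q (A : 'M[C]_(p, q)) : 'M[C]_(q, p) := map_mx Num.conj A^T.

Definition psdmx k (A : 'M[C]_k) : Prop :=
  adjmx A = A /\ forall v : 'cV[C]_k, 0 <= (adjmx v *m A *m v) ord0 ord0.

Definition density k (A : 'M[C]_k) : Prop := psdmx A /\ \tr A = 1.

(* the (unique) psd square root of a psd matrix, chosen by Hilbert's epsilon *)
Definition sqrtmx k (A : 'M[C]_k) : 'M[C]_k :=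
  epsilon (inhabits 0) (fun B : 'M[C]_k => psdmx B /\ B *m B = A).

(* Kronecker product A (x) B, with the index (i,a) |-> mxvec_index i a,
   i.e. the first factor is the outer one (H_a (x) H_b). *)
Definition kronmx p q r s (A : 'M[C]_(p, q)) (B : 'M[C]_(r, s))
  : 'M[C]_(p * r, q * s) :=
  \matrix_(k, l) \sum_(i < p) \sum_(a < r) \sum_(j < q) \sum_(b < s)
     (if (k == mxvec_index i a) && (l == mxvec_index j b)
      then A i j * B a b else 0).

Definition ketbra n (i j : 'I_n) : 'M[C]_n := delta_mx i j.

Definition probvec n (p : 'I_n -> C) : Prop :=
  (forall i, 0 <= p i) /\ \sum_(i < n) p i = 1.

Definition qsd_state n m (rho : 'I_n -> 'M[C]_m) (eta : 'I_n -> C)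
  : 'M[C]_(n * m) :=
  \sum_(i < n) \sum_(j < n)
    kronmx (ketbra i j) (sqrtmx (eta i *: rho i) *m sqrtmx (eta j *: rho j)).

Definition partial_incoherent n m (sigma : 'M[C]_(n * m)) : Prop :=
  exists (p : 'I_n -> C) (s : 'I_n -> 'M[C]_m),
    probvec p /\ (forall i, density (s i)) /\
    sigma = \sum_(i < n) kronmx (ketbra i i) (p i *: s i).

Definition fidelity k (rho sigma : 'M[C]_k) : C :=
  \tr (sqrtmx (sqrtmx sigma *m rho *m sqrtmx sigma)).

Definition is_CaF n m (rho : 'M[C]_(n * m)) (cF : C) : Prop :=
  (exists sigma, partial_incoherent sigma /\ cF = 1 - fidelity rho sigma ^+ 2) /\
  (forall sigma, partial_incoherent sigma -> cF <= 1 - fidelity rho sigma ^+ 2).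

Definition povm n m (M : 'I_n -> 'M[C]_m) : Prop :=
  (forall i, psdmx (M i)) /\ \sum_(i < n) M i = 1%:M.

Definition succ_prob n m (rho : 'I_n -> 'M[C]_m) (eta : 'I_n -> C)
  (M : 'I_n -> 'M[C]_m) : C :=
  \sum_(i < n) eta i * \tr (M i *m rho i).

Definition is_PoptE n m (rho : 'I_n -> 'M[C]_m) (eta : 'I_n -> C) (pE : C) : Prop :=
  (exists M, povm M /\ pE = 1 - succ_prob rho eta M) /\
  (forall M, povm M -> succ_prob rho eta M <= 1 - pE).

(* Linear independence of states: for spectral decompositions
   rho_i = sum_j lambda_ij |psi_ij><psi_ij| (lambda_ij > 0, psi_i. orthonormal),
   the whole family {psi_ij}_{i,j} is linearly independent. *)
Definition states_lin_indep n m (rho : 'I_n -> 'M[C]_m) : Prop :=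
  exists (k : 'I_n -> nat) (lam : forall i, 'I_(k i) -> C)
         (psi : forall i, 'I_(k i) -> 'cV[C]_m),
    (forall i j, 0 < lam i j) /\
    (forall i j j', (adjmx (psi i j) *m psi i j') ord0 ord0 = (j == j')%:R) /\
    (forall i, rho i = \sum_(j < k i) lam i j *: (psi i j *m adjmx (psi i j))) /\
    (forall c : forall i, 'I_(k i) -> C,
        \sum_(i < n) \sum_(j < k i) c i j *: psi i j = 0 ->
        forall i j, c i j = 0).

End QSD.

(* Main.v *)
(* Write rho = A A^* with A the column of the blocks sqrt(eta_i rho_i), and let
   G = sqrt(sigma) A, so that F(rho, sigma) = tr |G^*| is the maximum of
   Re tr (G V) over the contractions V.  Since sqrt(sigma) is block diagonal,
   only the products sqrt(sigma)_i sqrt(eta_i rho_i) V_i contribute, and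
   V V^* = sum_i V_i V_i^* <= 1 says that M_i = V_i V_i^* is a (sub-)POVM.
   Cauchy-Schwarz bounds the square of the trace by
   sum_i eta_i tr (M_i rho_i); conversely, choosing V_i by polar decomposition
   so that T_i = sqrt(eta_i rho_i) V_i is positive, sigma_i ~ T_i^2 attains it.
   Hence max_sigma F^2 is the optimal success probability for every ensemble,
   linearly independent or not.

   C need not be complete, so that compactness does not provide the optimal
   POVM.  Instead, the real elements of C form a real closed field; by
   quantifier elimination its definable subsets of the line have suprema, and
   this is enough for a polynomial to attain its minimum on a bounded real
   algebraic set: approximate minimisers are pinned down one coordinate at a
   time. *)
Require Import Defs.
From HB Require Import structures.
From Stdlib Require Classical_Prop.
From mathcomp Require Import all_boot all_order all_algebra polyrcf.
From mathcomp Require ordered_qelim qe_rcf.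
Set Implicit Arguments. Unset Strict Implicit. Unset Printing Implicit Defensive.
Import Order.TTheory GRing.Theory Num.Theory.
Local Open Scope ring_scope.

Module ord := ordered_qelim.ord.

(** * The real closed subfield of a numeric closed field *)

Section RealSubfield.
Variable C : numClosedFieldType.

Record creal := in_creal {creal_val :> C; creal_valP : creal_val \is Num.real}.

HB.instance Definition _ := [isSub for creal_val].
HB.instance Definition _ := [Choice of creal by <:].
HB.instance Definition _ := [SubChoice_isSubIntegralDomain of creal by <:].
HB.instance Definition _ := [SubIntegralDomain_isSubField of creal by <:].
HB.instance Definition _ : Order.isPOrder ring_display creal :=
  Order.CancelPartial.Pcan _ valK.
Lemma creal_total : total (<=%O : rel (creal : porderType _)).
Proof. by move=> x y; apply/real_leVge/valP/valP. Qed.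
HB.instance Definition _ := Order.POrder_isTotal.Build _ creal creal_total.

Lemma creal_val_is_zmod_morphism : zmod_morphism creal_val. Proof. by []. Qed.
Lemma creal_val_is_monoid_morphism : monoid_morphism creal_val. Proof. by []. Qed.
HB.instance Definition _ := GRing.isZmodMorphism.Build creal C creal_val
  creal_val_is_zmod_morphism.
HB.instance Definition _ := GRing.isMonoidMorphism.Build creal C creal_val
  creal_val_is_monoid_morphism.

Definition creal_norm (x : creal) : creal := in_creal (normr_real (val x)).
Lemma creal_ler_normD x y : creal_norm (x + y) <= (creal_norm x + creal_norm y).
Proof. exact: ler_normD. Qed.
Lemma creal_normr0_eq0 x : creal_norm x = 0 -> x = 0.
Proof. by move=> /(congr1 val)/normr0_eq0 ?; apply/val_inj. Qed.
Lemma creal_normrMn x n : creal_norm (x *+ n) = creal_norm x *+ n.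
Proof. by apply/val_inj; rewrite /= !rmorphMn/= normrMn. Qed.
Lemma creal_normrN x : creal_norm (- x) = creal_norm x.
Proof. by apply/val_inj; apply: normrN. Qed.
Lemma creal_addr_gt0 (x y : creal) : 0 < x -> 0 < y -> 0 < x + y.
Proof. exact: (@addr_gt0 C). Qed.
Lemma creal_ger_leVge (x y : creal) : 0 <= x -> 0 <= y -> (x <= y) || (y <= x).
Proof. exact: (@ger_leVge C). Qed.
Lemma creal_normrM : {morph creal_norm : x y / x * y}.
Proof. by move=> *; apply/val_inj; apply: normrM. Qed.
Lemma creal_ler_def (x y : creal) : (x <= y) = (creal_norm (y - x) == y - x).
Proof. exact: (@ler_def C). Qed.

HB.instance Definition _ := Num.Zmodule_isNormed.Build _ creal
  creal_ler_normD creal_normr0_eq0 creal_normrMn creal_normrN.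
HB.instance Definition _ := Num.isNumRing.Build creal
  creal_addr_gt0 creal_ger_leVge creal_normrM creal_ler_def.

(* Induction on the degree: a real root outside [a, b] or a conjugate pair of
   non-real roots can be divided out without spoiling the change of sign. *)
Lemma creal_real_closed : Num.real_closed_axiom creal.
Proof.
move=> p a b le_ab /andP[pa_le0 pb_ge0].
have [n] := ubnP (size p).
elim: n p pa_le0 pb_ge0 => // n IHn p pa_le0 pb_ge0 size_p.
have [->|pN0] := eqVneq p 0; first by exists a; rewrite ?lexx ?root0.
pose pC := map_poly creal_val p.
have [size_p1|size_p1] := eqVneq (size p) 1%N.
  have /eqP/size_poly1P[c cN0 pE] := size_p1.
  move: pa_le0 pb_ge0; rewrite pE !hornerC => c_le0 c_ge0.
  by move: cN0; rewrite (le_anti (introT andP (conj c_le0 c_ge0))) eqxx.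
have /closed_rootP[z rz] : size pC != 1%N by rewrite size_map_poly.
have [zR|zNR] := boolP (z \is Num.real).
  pose x := in_creal zR.
  have rx : root p x by rewrite -(fmorph_root creal_val).
  have [xab|xNab] := boolP (a <= x <= b); first by exists x.
  have /dvdpP[q pE] : 'X - x%:P %| p by rewrite dvdp_XsubCl.
  have qN0 : q != 0 by apply: contraNneq pN0 => q0; rewrite pE q0 mul0r.
  have size_q : (size q < n)%N.
    move: size_p; rewrite pE size_mul ?polyXsubC_eq0// size_XsubC addn2/=.
    by rewrite ltnS.
  move: pa_le0 pb_ge0; rewrite pE !hornerM !hornerXsubC.
  move: xNab; rewrite negb_and -!ltNge => /orP[xa|bx].
    have xb := lt_le_trans xa le_ab.
    rewrite pmulr_lle0 ?subr_gt0// pmulr_lge0 ?subr_gt0// => qa qb.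
    by have [y yab ry] := IHn q qa qb size_q; exists y; rewrite // rootM ry.
  have ax := le_lt_trans le_ab bx.
  (* A root to the right of [b] makes the linear factor negative on [a, b], so the quotient changes
     sign in the opposite direction and the induction applies to [- q]. *)
  rewrite nmulr_lle0 ?subr_lt0// nmulr_lge0 ?subr_lt0// => qa qb.
  have [|||y yab ry] := IHn (- q); rewrite ?hornerN ?oppr_le0 ?oppr_ge0 ?size_polyN//.
  by exists y; rewrite // rootM -[q]opprK rootN ry.
(* The real form of the product of X - z and X - conj z. It takes the value |x - z|^2 > 0 at a real
   x, so dividing by it preserves signs. *)
pose q : {poly creal} := 'X^2 - (in_creal (Creal_Re z) *+ 2) *: 'X
   + ((in_creal (normr_real z)) ^+ 2)%:P.
have qC : map_poly creal_val q = ('X - z%:P) * ('X - z^*%:P).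
  rewrite rmorphD /= rmorphB/= !map_polyZ !map_polyXn/= map_polyX.
  rewrite (map_polyC creal_val)/=.
  rewrite mulrBl !mulrBr -!addrA; congr (_ + _).
  rewrite opprD addrA opprK -opprD -rmorphM/= -normCK; congr (- _ + _).
  rewrite mulrC !mul_polyC -scalerDl.
  by rewrite ReE -splitr addrC.
have rzJ : root pC z^*.
  have pCE : pC = map_poly Num.conj pC.
    rewrite -map_poly_comp; apply: eq_map_poly => x /=.
    by rewrite (CrealP (creal_valP x)).
  by rewrite pCE mapf_root.
have zJ : z^* != z by apply: contraNneq zNR => /CrealP.
have : q %| p.
  rewrite -(dvdp_map creal_val) qC Gauss_dvdp.
    by rewrite !dvdp_XsubCl rz rzJ.
  by rewrite coprimep_XsubC root_XsubC.
move=> /dvdpP[r pE].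
have q_gt0 x : 0 < q.[x].
  have -> : (0 < q.[x]) = (0 < creal_val q.[x]) by [].
  rewrite -horner_map qC /= hornerM !hornerXsubC.
  have -> : creal_val x - z^* = (creal_val x - z)^*.
    by rewrite rmorphB /= (CrealP (creal_valP x)).
  rewrite -normCK exprn_gt0// normr_gt0 subr_eq0.
  by apply: contraNneq zNR => <-; apply: creal_valP.
have rN0 : r != 0 by apply: contraNneq pN0 => r0; rewrite pE r0 mul0r.
have qN0 : q != 0 by apply: contraNneq pN0 => q0; rewrite pE q0 mulr0.
have size_q : size q = 3%N.
  rewrite -(size_map_poly creal_val) qC size_mul ?polyXsubC_eq0//.
  by rewrite !size_XsubC.
have size_r : (size r < n)%N.
  apply: leq_trans _ (ltnSE size_p); rewrite pE size_mul// size_q addn3/=.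
  by rewrite ltnS leqnSn.
move: pa_le0 pb_ge0; rewrite pE !hornerM pmulr_lle0// pmulr_lge0// => ra rb.
by have [y yab ry] := IHn r ra rb size_r; exists y; rewrite // rootM ry.
Qed.
HB.instance Definition _ := Num.RealField_isClosed.Build creal creal_real_closed.

End RealSubfield.

(** * Extreme values over a real closed field *)

Section Definable.
Variable F : rcfType.
Implicit Types (t : GRing.term F) (f : ord.formula F) (e : seq F).

Lemma rterm_horner t e i : GRing.rterm t ->
  exists p : {poly F}, forall x, GRing.eval (set_nth 0 e i x) t = p.[x].
Proof.
elim: t => //=.
- move=> n _; have [->|ni] := eqVneq n i.
    by exists 'X => x; rewrite nth_set_nth /= eqxx hornerX.
  by exists (e`_n)%:P => x; rewrite nth_set_nth /= (negPf ni) hornerC.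
- by move=> c _; exists c%:P => x; rewrite hornerC.
- by move=> n _; exists n%:R%:P => x; rewrite hornerC.
- move=> t1 IH1 t2 IH2 /andP[/IH1[p1 E1] /IH2[p2 E2]].
  by exists (p1 + p2) => x; rewrite hornerD E1 E2.
- by move=> t1 IH1 /IH1[p1 E1]; exists (- p1) => x; rewrite hornerN E1.
- by move=> t1 IH1 n /IH1[p1 E1]; exists (p1 *+ n) => x; rewrite hornerMn E1.
- move=> t1 IH1 t2 IH2 /andP[/IH1[p1 E1] /IH2[p2 E2]].
  by exists (p1 * p2) => x; rewrite hornerM E1 E2.
- by move=> t1 IH1 n /IH1[p1 E1]; exists (p1 ^+ n) => x; rewrite horner_exp E1.
Qed.

Definition rootless (p : {poly F}) (x y : F) := forall z : F, x <= z <= y -> ~~ root p z.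

Lemma rterm_sgr t1 t2 e i : GRing.rterm t1 -> GRing.rterm t2 ->
  exists2 p : {poly F}, p != 0 & forall x y : F, x <= y -> rootless p x y ->
    let d v := GRing.eval (set_nth 0 e i v) t1 - GRing.eval (set_nth 0 e i v) t2 in
    Num.sg (d x) = Num.sg (d y).
Proof.
move=> /(@rterm_horner _ e i)[p1 E1] /(@rterm_horner _ e i)[p2 E2].
(* If the two terms agree as polynomials, the difference is identically zero and the constant 1
   serves as the nonzero polynomial. *)
have [p12|p12] := eqVneq (p1 - p2) 0.
  exists 1; first exact: oner_neq0.
  by move=> x y _ _ /=; rewrite !E1 !E2 -!hornerN -!hornerD p12 !horner0.
exists (p1 - p2) => // x y xy nr /=; rewrite !E1 !E2 -!hornerN -!hornerD.
apply: (@polyrN0_itv _ `[x, y]).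
- by move=> z; rewrite in_itv /= => /nr.
- by rewrite in_itv /= xy lexx.
- by rewrite in_itv /= lexx.
Qed.

(** An atom depends only on the sign of a difference of two terms, which is constant between roots
    by the intermediate value property. Multiplying the polynomials of the subformulas controls all
    atoms at once. *)
Lemma qf_eval_rootless f e i : ord.qf_form f -> ord.rformula f ->
  exists2 p : {poly F}, p != 0 & forall x y : F, x <= y -> rootless p x y ->
    ord.qf_eval (set_nth 0 e i x) f = ord.qf_eval (set_nth 0 e i y) f.
Proof.
have rootlessM (p q : {poly F}) x y :
    rootless (p * q) x y -> rootless p x y /\ rootless q x y.
  by move=> pq; split=> z /pq; rewrite rootM negb_or => /andP[].
elim: f => //=.
- by move=> b _ _; exists 1; first exact: oner_neq0.
- move=> t1 t2 _ /andP[/rterm_sgr + /[dup]] => /[apply] /(_ e i)[p p0 pP] _.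
  exists p => // x y xy /(pP _ _ xy) /= sg.
  by rewrite -subr_eq0 -sgr_eq0 sg sgr_eq0 subr_eq0.
- move=> t1 t2 _ /andP[/rterm_sgr + /[dup]] => /[apply] /(_ e i)[p p0 pP] _.
  exists p => // x y xy /(pP _ _ xy) /= sg.
  by rewrite -subr_lt0 -sgr_lt0 sg sgr_lt0 subr_lt0.
- move=> t1 t2 _ /andP[/rterm_sgr + /[dup]] => /[apply] /(_ e i)[p p0 pP] _.
  exists p => // x y xy /(pP _ _ xy) /= sg.
  by rewrite -subr_le0 -sgr_le0 sg sgr_le0 subr_le0.
- move=> f1 IH1 f2 IH2 /andP[q1 q2] /andP[r1 r2].
  have [p1 p10 P1] := IH1 q1 r1; have [p2 p20 P2] := IH2 q2 r2.
  exists (p1 * p2) => [|x y xy /rootlessM[/(P1 _ _ xy)-> /(P2 _ _ xy)->]//].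
  exact: mulf_neq0.
- move=> f1 IH1 f2 IH2 /andP[q1 q2] /andP[r1 r2].
  have [p1 p10 P1] := IH1 q1 r1; have [p2 p20 P2] := IH2 q2 r2.
  exists (p1 * p2) => [|x y xy /rootlessM[/(P1 _ _ xy)-> /(P2 _ _ xy)->]//].
  exact: mulf_neq0.
- move=> f1 IH1 f2 IH2 /andP[q1 q2] /andP[r1 r2].
  have [p1 p10 P1] := IH1 q1 r1; have [p2 p20 P2] := IH2 q2 r2.
  exists (p1 * p2) => [|x y xy /rootlessM[/(P1 _ _ xy)-> /(P2 _ _ xy)->]//].
  exact: mulf_neq0.
- move=> f1 IH1 q1 r1; have [p1 p10 P1] := IH1 q1 r1.
  by exists p1 => // x y xy /(P1 _ _ xy)->.
Qed.

(* A definable subset of the line only changes at the roots of some nonzero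
   polynomial, so the cut defined by a down-closed one is located at one of
   finitely many points; no completeness of F is involved. *)
Lemma definable_sup f e i :
  let P (v : F) := ord.holds (set_nth 0 e i v) f in
  (forall x y : F, x <= y -> P y -> P x) -> (exists a, P a) -> (exists b, ~ P b) ->
  exists s, (forall x : F, x < s -> P x) /\ (forall x : F, s < x -> ~ P x).
Proof.
move=> P downP [a Pa] [b nPb].
have rf := ord.to_rform_rformula f.
(* Quantifier elimination replaces [f] by the quantifier-free [g], whose truth value [B v] is a
   boolean. *)
pose wproj i bc := qe_rcf.qfr_to_formula (@qe_rcf.wproj F i bc).
pose g := ord.quantifier_elim wproj (ord.to_rform f).
pose B v := ord.qf_eval (set_nth 0 e i v) g.
have BP v : reflect (P v) (B v).
  apply: (iffP (ord.quantifier_elim_rformP (@qe_rcf.wf_QE_wproj F)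
    (@qe_rcf.valid_QE_wproj F) (set_nth 0 e i v) rf)).
    by move/ord.to_rformP.
  by move=> ?; apply/ord.to_rformP.
have /andP[qg rg] := ord.quantifier_elim_wf (@qe_rcf.wf_QE_wproj F) rf.
have [p p0 pP] := qf_eval_rootless e i qg rg.
have downB (x y : F) : x <= y -> B y -> B x by move=> xy /BP/(downP _ _ xy)/BP.
have Ba : B a by apply/BP.
have nBb : ~~ B b by apply/BP.
pose rs := rootsR p.
have rsP z : root p z -> z \in rs by move=> pz; rewrite -(roots_on_rootsR p0) in_itv.
(* [u] is the last known point inside the set and [w] the first known point outside it, among the
   roots and [a], [b]. No root lies strictly between them. *)
pose u := \big[Num.max/a]_(z <- rs | B z) z.
pose w := \big[Num.min/b]_(z <- rs | ~~ B z) z.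
have Bu : B u by rewrite /u; elim/big_ind: _ => // x y Bx By; rewrite maxEle; case: ifP.
have nBw : ~~ B w.
  by rewrite /w; elim/big_ind: _ => // x y Bx By; rewrite minEle; case: ifP.
have uw : u < w by rewrite ltNge; apply: contra nBw => /downB; apply.
have nr (x y : F) : u < x -> y < w -> rootless p x y.
  move=> ux yw z /andP[xz zy]; apply/negP => /rsP zrs.
  have [Bz|nBz] := boolP (B z).
    have : z <= u by apply: (@le_bigmax_seq _ F).
    by rewrite leNgt (lt_le_trans ux xz).
  have : w <= z by apply: (@ge_bigmin_seq _ F).
  by rewrite leNgt (le_lt_trans zy yw).
(* [B] is constant strictly between [u] and [w], so its value at the midpoint decides whether the
   cut is at [w] or at [u]. *)
pose c := (u + w) / 2.
have uc : u < c by rewrite midf_lt.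
have cw : c < w by rewrite midf_lt.
have [Bc|nBc] := boolP (B c).
  exists w; split=> x.
    move=> xw; apply/BP; have [xc|/ltW cx] := leP x c; first exact: downB Bc.
    by rewrite /B -(pP _ _ cx)//; exact: nr.
  by move=> /ltW wx /BP/(downB _ _ wx); apply/negP.
exists u; split=> x; first by move=> /ltW xu; apply/BP; exact: downB Bu.
move=> ux; apply/BP; have [cx|/ltW xc] := leP c x.
  by apply: contra nBc; exact: downB.
by rewrite /B (pP _ _ xc)//; exact: nr.
Qed.

End Definable.

(** * Polynomial functions and their minima on bounded real algebraic sets *)

Section ExtremeValue.
Variable F : rcfType.

(** Polynomials are given by division-free terms so that they can occur in first-order formulas; the
    arbitrary tail [r] leaves room for further variables after the N coordinates. *)
Definition polyfun N (h : N.-tuple F -> F) : Prop :=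
  exists2 t, GRing.rterm t & forall (x : N.-tuple F) r, GRing.eval (x ++ r) t = h x.

Lemma polyfun_coord N (i : 'I_N) : polyfun (fun x : N.-tuple F => tnth x i).
Proof.
exists (GRing.Var F i) => //= x r.
by rewrite nth_cat size_tuple ltn_ord -tnth_nth.
Qed.

Lemma polyfun_cst N c : polyfun (fun _ : N.-tuple F => c).
Proof. by exists (GRing.Const c). Qed.

Lemma polyfunD N (g h : N.-tuple F -> F) :
  polyfun g -> polyfun h -> polyfun (fun x => g x + h x).
Proof.
move=> [t rt tE] [u ru uE]; exists (GRing.Add t u) => [|x r] /=; first by rewrite rt.
by rewrite tE uE.
Qed.

Lemma polyfunM N (g h : N.-tuple F -> F) :
  polyfun g -> polyfun h -> polyfun (fun x => g x * h x).
Proof.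
move=> [t rt tE] [u ru uE]; exists (GRing.Mul t u) => [|x r] /=; first by rewrite rt.
by rewrite tE uE.
Qed.

Lemma polyfunN N (g : N.-tuple F -> F) : polyfun g -> polyfun (fun x => - g x).
Proof. by move=> [t rt tE]; exists (GRing.Opp t) => [|x r] //=; rewrite tE. Qed.

Lemma rterm_continuous (t : GRing.term F) (e : seq F) (eps : F) :
  GRing.rterm t -> 0 < eps -> exists2 d, 0 < d & forall e' : seq F,
    (forall i, `|e'`_i - e`_i| <= d) -> `|GRing.eval e' t - GRing.eval e t| <= eps.
Proof.
pose cont (u : seq F -> F) := forall eps, 0 < eps -> exists2 d, 0 < d &
  forall e' : seq F, (forall i, `|e'`_i - e`_i| <= d) -> `|u e' - u e| <= eps.
have cst c : cont (fun=> c).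
  by move=> a a0; exists 1; rewrite ?ltr01// => e' _; rewrite subrr normr0 ltW.
have close d1 d2 e' : (forall i, `|e'`_i - e`_i| <= Num.min d1 d2) ->
    (forall i, `|e'`_i - e`_i| <= d1) /\ (forall i, `|e'`_i - e`_i| <= d2).
  by move=> H; split=> i; have := H i; rewrite le_min => /andP[].
have contD u v : cont u -> cont v -> cont (fun e => u e + v e).
  move=> cu cv a a0; have a2 : 0 < a / 2 by rewrite divr_gt0// ltr0n.
  have [d1 d10 D1] := cu _ a2; have [d2 d20 D2] := cv _ a2.
  exists (Num.min d1 d2); first by rewrite lt_min d10.
  move=> e' /close[/D1 H1 /D2 H2]; rewrite opprD addrACA (splitr a).
  exact: le_trans (ler_normD _ _) (lerD H1 H2).
have contM u v : cont u -> cont v -> cont (fun e => u e * v e).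
  (* [m] bounds both |u e| and |v e'| once [v] moves by at most 1; each of the two terms of the
     split difference below is then at most half of [a]. *)
  move=> cu cv a a0; pose m := `|u e| + `|v e| + 1.
  have m0 : 0 < m by rewrite ltr_wpDl// addr_ge0.
  have c0 : 0 < Num.min 1 (a / (m + m)).
    by rewrite lt_min ltr01 divr_gt0// addr_gt0.
  have [d1 d10 D1] := cu _ c0; have [d2 d20 D2] := cv _ c0.
  exists (Num.min d1 d2); first by rewrite lt_min d10.
  move=> e' /close[/D1 + /D2]; rewrite !le_min => /andP[_ H1] /andP[H2 H2'].
  have -> : u e' * v e' - u e * v e = (u e' - u e) * v e' + u e * (v e' - v e).
    by rewrite mulrBl mulrBr addrA addrNK.
  apply: le_trans (ler_normD _ _) _; rewrite !normrM.
  have v'm : `|v e'| <= m.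
    rewrite -[v e'](subrK (v e)); apply: le_trans (ler_normD _ _) _.
    apply: le_trans (lerD H2 (lexx _)) _.
    by rewrite /m -addrA [1 + _]addrC lerDr.
  have um : `|u e| <= m by rewrite /m -addrA lerDl addr_ge0.
  have -> : a = a / (m + m) * m + m * (a / (m + m)).
    by rewrite [m * _]mulrC -mulrDr divfK// gt_eqF// addr_gt0.
  by apply: lerD; apply: ler_pM.
have contX u n : cont u -> cont (fun e => u e ^+ n).
  move=> cu; elim: n => [|n IHn]; first exact: cst.
  by move=> a /(contM _ _ cu IHn)[d d0 D]; exists d => // e' /D; rewrite !exprS.
have contMn u n : cont u -> cont (fun e => u e *+ n).
  move=> cu; elim: n => [|n IHn]; first exact: cst.
  by move=> a /(contD _ _ cu IHn)[d d0 D]; exists d => // e' /D; rewrite !mulrS.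
suff: GRing.rterm t -> cont (fun e => GRing.eval e t) by move=> /[apply] /[apply].
elim: t => [n|c|n|t1 IH1 t2 IH2|t1 IH1|t1 IH1 n|t1 IH1 t2 IH2|t1 IH1|t1 IH1 n] //=.
- by move=> _ a a0; exists a.
- by move=> /andP[/IH1 c1 /IH2 c2]; exact: contD.
- move=> /IH1 c1 a /c1[d d0 D]; exists d => // e' /D.
  by rewrite -normrN opprB opprK addrC.
- by move=> /IH1; apply: contMn.
- by move=> /andP[/IH1 c1 /IH2 c2]; exact: contM.
- by move=> /IH1; apply: contX.
Qed.

Lemma polyfun_continuous N (h : N.-tuple F -> F) (c : N.-tuple F) (eps : F) :
  polyfun h -> 0 < eps -> exists2 d, 0 < d & forall x : N.-tuple F,
    (forall i, `|tnth x i - tnth c i| <= d) -> `|h x - h c| <= eps.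
Proof.
move=> [t rt tE] /(rterm_continuous c rt)[d d0 D]; exists d => // x xc.
rewrite -(tE x [::]) -(tE c [::]) !cats0; apply: D => i.
have [iN|Ni] := ltnP i N; last by rewrite !nth_default ?size_tuple// subrr normr0 ltW.
by have := xc (Ordinal iN); rewrite !(tnth_nth 0).
Qed.

(** Serves to quantify over all coordinates of a tuple at once: the quantifiers overwrite the block
    [y] of the valuation, whose old content does not matter. *)
Lemma holds_exists_prefix (f : ord.formula F) (s y r : seq F) :
  ord.holds (s ++ y ++ r) (foldr (@ord.Exists F) f (iota (size s) (size y))) <->
  exists2 x, size x = size y & ord.holds (s ++ x ++ r) f.
Proof.
elim: y s => [|a y IHy] s /=.
  by split=> [|[x /size0nil->]]//; exists [::].
have set_sE v : set_nth 0 (s ++ a :: y ++ r) (size s) v = rcons s v ++ y ++ r.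
  by elim: (s) => //= b s' ->.
split=> [[v]|[[//|v x] [size_x] fx]].
  rewrite set_sE -(size_rcons s v) => /IHy[x size_x fx].
  by exists (v :: x); rewrite /= ?size_x// -cat_rcons.
exists v; rewrite set_sE -(size_rcons s v); apply/IHy.
by exists x => //; rewrite cat_rcons.
Qed.

Definition definable_family N (Q : F -> N.-tuple F -> Prop) : Prop :=
  exists f, forall (x : N.-tuple F) eps r, ord.holds (x ++ eps :: r) f <-> Q eps x.

(** A definable filter base indexed by eps > 0, in place of a minimising sequence. Definability is
    what guarantees that limits along it exist in [F]. *)
Definition shrinking_family N (Q : F -> N.-tuple F -> Prop) : Prop :=
  [/\ definable_family Q,
      forall eps eps' x, eps <= eps' -> Q eps x -> Q eps' x &
      forall eps, 0 < eps -> exists x, Q eps x].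

(** [s] is the lower limit of [h] along the family: the numbers that are eventually lower bounds of
    [h] form a definable, down-closed set with bounded supremum. Restricting to points where [h] is
    near [s] keeps the sets nonempty. *)
Lemma shrinking_liminf N (Q : F -> N.-tuple F -> Prop) h b :
  shrinking_family Q -> polyfun h -> (forall eps x, Q eps x -> `|h x| <= b) ->
  exists s, shrinking_family (fun eps x => Q eps x /\ `|h x - s| <= eps) /\
    forall t, t < s -> exists2 eps, 0 < eps & forall x, Q eps x -> t <= h x.
Proof.
move=> [[f fP] monoQ exQ] [u ru uP] bQ.
pose P v := exists2 eps, 0 < eps & forall x, Q eps x -> v <= h x.
(* The formula for [P v]: for some eps > 0, no x satisfies both [Q eps x] and [h x < v]. Variables 0
   to N-1 hold x, variable N holds eps and variable N+1 holds v. *)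
pose psi := ord.Exists N (ord.And (ord.Lt (GRing.NatConst _ 0) (GRing.Var F N))
  (ord.Not (foldr (@ord.Exists F) (ord.And f (ord.Lt u (GRing.Var F N.+1))) (iota 0 N)))).
pose e : seq F := nseq N 0 ++ [:: 0; 0].
have setE eps v : set_nth 0 (set_nth 0 e N.+1 v) N eps = nseq N 0 ++ [:: eps; v].
  by rewrite /e; elim: (N) => //= n ->.
have PE v : ord.holds (set_nth 0 e N.+1 v) psi <-> P v.
  have innerE eps : ord.holds (nseq N 0 ++ [:: eps; v]) (foldr (@ord.Exists F)
      (ord.And f (ord.Lt u (GRing.Var F N.+1))) (iota 0 N)) <->
      exists2 x, Q eps x & h x < v.
    have := @holds_exists_prefix (ord.And f (ord.Lt u (GRing.Var F N.+1)))
      [::] (nseq N 0) [:: eps; v].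
    rewrite /= size_nseq => ->.
    split=> [[x size_x /= [fx ux]]|[x Qx hx]].
      pose y : N.-tuple F := Tuple (introT eqP size_x).
      have yE : x = y by [].
      exists y; first by apply/fP; rewrite -yE; exact: fx.
      move: ux; rewrite -/(GRing.eval _ _) /= yE uP nth_cat size_tuple ltnNge leqnSn /=.
      by rewrite subSnn.
    exists x; first by rewrite size_tuple.
    split; first by apply/fP.
    by rewrite /= uP nth_cat size_tuple ltnNge leqnSn /= subSnn.
  split=> [[eps]|[eps eps0 Heps]].
    rewrite setE /= nth_cat size_nseq ltnn subnn /= => -[eps0 nex].
    exists eps => // x Qx; rewrite leNgt; apply/negP => hx; apply: nex.
    by apply/innerE; exists x.
  exists eps; rewrite setE /= nth_cat size_nseq ltnn subnn /=; split=> //.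
  by move=> /innerE[x /Heps]; rewrite leNgt => /negP.
have [||| s [ltS gtS]] := @definable_sup F psi e N.+1.
- move=> x y xy /PE[eps eps0 H]; apply/PE; exists eps => // z /H.
  exact: le_trans.
- exists (- b); apply/PE; exists 1; first exact: ltr01.
  by move=> x /bQ; rewrite ler_norml => /andP[].
- exists (b + 1) => /PE[eps eps0 H]; have [x Qx] := exQ _ eps0.
  have := H _ Qx; have := bQ _ _ Qx; rewrite ler_norml => /andP[_ hb] bh.
  by have := le_trans bh hb; rewrite gerDl ler10.
exists s; split; last by move=> t /ltS/PE.
split.
- exists (ord.And f (ord.And (ord.Le (GRing.Add u (GRing.Const (- s))) (GRing.Var F N))
     (ord.Le (GRing.Opp (GRing.Var F N)) (GRing.Add u (GRing.Const (- s)))))).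
  move=> x eps r /=; rewrite uP nth_cat size_tuple ltnn subnn /= ler_norml.
  split=> [[/fP Qx [-> ->]]//|[/fP fx /andP[]]].
  by [].
- move=> eps eps' x le_eps [Qx hx]; split; first exact: monoQ Qx.
  exact: le_trans le_eps.
(* [s - eps] is a lower bound from some [eps1] on, while [s + eps] never becomes one; a point
   violating the latter at the smaller of [eps] and [eps1] has [h] within [eps] of [s]. *)
- move=> eps eps0; have : s - eps < s by rewrite gtrDl oppr_lt0.
  move=> /ltS/PE[eps1 eps10 H1].
  have m0 : 0 < Num.min eps eps1 by rewrite lt_min eps0.
  have : s < s + eps by rewrite ltrDl.
  move=> /gtS/PE nP.
  have [x [Qx hx]] : exists x, Q (Num.min eps eps1) x /\ h x < s + eps.
    apply: Classical_Prop.NNPP => nex; apply: nP.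
    exists (Num.min eps eps1) => // x Qx; rewrite leNgt; apply/negP => hx.
    by apply: nex; exists x.
  exists x; split; first by apply: monoQ Qx; rewrite ge_min lexx.
  rewrite ler_distl (ltW hx) andbT lerBlDr -lerBlDr; apply: H1.
  by apply: monoQ Qx; rewrite ge_min lexx orbT.
Qed.

(** The substitute for Bolzano-Weierstrass: each coordinate in turn is pinned near its lower limit,
    which yields a new shrinking family for the remaining ones. *)
Lemma shrinking_cluster N (Q : F -> N.-tuple F -> Prop) b :
  shrinking_family Q -> (forall eps x i, Q eps x -> `|tnth x i| <= b) ->
  exists c : N.-tuple F, forall eps, 0 < eps ->
    exists2 x, Q eps x & forall i, `|tnth x i - tnth c i| <= eps.
Proof.
move=> shQ bQ.
suff: forall k, (k <= N)%N -> exists c : nat -> F, forall eps, 0 < eps ->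
    exists2 x, Q eps x & forall i : 'I_N, (i < k)%N -> `|tnth x i - c i| <= eps.
  move=> /(_ N (leqnn N))[c cP]; exists [tuple c i | i < N] => eps /cP[x Qx xc].
  by exists x => // i; rewrite tnth_mktuple; apply: xc.
(* The family is generalised in the induction, since pinning coordinate k changes it before the
   hypothesis is applied to the coordinates below k. *)
move=> k; elim: k => [|k IHk] in Q shQ bQ *.
  move=> _; exists (fun=> 0) => eps eps0.
  by have [_ _ /(_ _ eps0)[x Qx]] := shQ; exists x.
move=> kN; pose i0 := Ordinal kN.
have [|s [shQs _]] := shrinking_liminf shQ (polyfun_coord i0) (b := b).
  by move=> eps x; exact: bQ.
have [|c cP] := IHk _ shQs _ (ltnW kN); first by move=> eps x i [/bQ].
exists (fun j => if j == k then s else c j) => eps /cP[x [Qx xs] xc].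
exists x => // i; rewrite ltnS leq_eqVlt; have [ik _|ik /= ltik] := eqVneq (i : nat) k.
  by have -> : i = i0 by apply: val_inj.
exact: xc.
Qed.

(** Start from the constant family {g = 0}, narrow it to points where [h] is near its infimum [s],
    and take a cluster point [c]. Continuity then gives g c = 0 and h c = s. *)
Theorem polyfun_attains_min N (g h : N.-tuple F -> F) b b' :
  polyfun g -> polyfun h -> (exists x, g x = 0) ->
  (forall x i, g x = 0 -> `|tnth x i| <= b) ->
  (forall x, g x = 0 -> `|h x| <= b') ->
  exists2 x, g x = 0 & forall y, g y = 0 -> h x <= h y.
Proof.
move=> pg ph [x0 gx0] bx bh.
have shQ : shrinking_family (fun (_ : F) x => g x = 0).
  split=> //; last by move=> eps _; exists x0.
  have [t rt tE] := pg; exists (ord.Equal t (GRing.NatConst _ 0)) => x eps r /=.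
  by rewrite tE.
have [|s [shQs minS]] := shrinking_liminf shQ ph (b := b'); first by move=> _; exact: bh.
have [|c cP] := shrinking_cluster (b := b) shQs.
  by move=> eps x i [gx _]; exact: bx.
have eq0 (a : F) : (forall eps : F, 0 < eps -> `|a| <= eps) -> a = 0.
  move=> aP; apply/eqP; rewrite -normr_le0 leNgt; apply/negP => a0.
  have := aP (`|a| / 2); rewrite divr_gt0 ?ltr0n// => /(_ isT).
  by rewrite leNgt ltr_pdivrMr ?ltr0n// mulr_natr mulr2n ltrDl a0.
exists c.
  apply: eq0 => eps eps0; have [d d0 D] := polyfun_continuous c pg eps0.
  by have [x [gx _] /D] := cP _ d0; rewrite gx sub0r normrN.
suff -> : h c = s.
  move=> y gy; rewrite leNgt; apply/negP => hy.
  (* A value of [h] below [s] would lie below the midpoint, which is itself a lower bound of [h] on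
     {g = 0}. *)
  have /minS[_ _ /(_ y gy)] : (h y + s) / 2 < s by rewrite midf_lt.
  by rewrite leNgt midf_lt.
apply/eqP; rewrite -subr_eq0; apply/eqP/eq0 => eps eps0.
have eps20 : 0 < eps / 2 by rewrite divr_gt0 ?ltr0n.
have [d d0 D] := polyfun_continuous c ph eps20.
have m0 : 0 < Num.min d (eps / 2) by rewrite lt_min d0.
have [x [_ hx] xc] := cP _ m0.
have hxc : `|h x - h c| <= eps / 2.
  by apply: D => i; apply: le_trans (xc i) _; rewrite ge_min lexx.
rewrite -[h c](subrK (h x)) -addrA (splitr eps); apply: le_trans (ler_normD _ _) _.
by rewrite distrC lerD// (le_trans hx)// ge_min lexx orbT.
Qed.

End ExtremeValue.

(** * Positive semidefinite matrices *)

Section PositiveMatrices.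
Variable C : numClosedFieldType.

Lemma adjmxK p q (A : 'M[C]_(p, q)) : adjmx (adjmx A) = A.
Proof. exact: trmxCK. Qed.

Lemma adjmxM p q r (A : 'M[C]_(p, q)) (B : 'M[C]_(q, r)) :
  adjmx (A *m B) = adjmx B *m adjmx A.
Proof. by rewrite /adjmx trmx_mul map_mxM. Qed.

Lemma adjmxD p q (A B : 'M[C]_(p, q)) : adjmx (A + B) = adjmx A + adjmx B.
Proof. by rewrite /adjmx linearD map_mxD. Qed.

Lemma adjmxN p q (A : 'M[C]_(p, q)) : adjmx (- A) = - adjmx A.
Proof. by rewrite /adjmx linearN map_mxN. Qed.

Lemma adjmxZ p q a (A : 'M[C]_(p, q)) : adjmx (a *: A) = a^* *: adjmx A.
Proof. by rewrite /adjmx linearZ map_mxZ. Qed.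

Lemma adjmx0 p q : adjmx (0 : 'M[C]_(p, q)) = 0.
Proof. by rewrite /adjmx trmx0 map_mx0. Qed.

Lemma adjmx1 p : adjmx (1%:M : 'M[C]_p) = 1%:M.
Proof. by rewrite /adjmx trmx1 map_mx1. Qed.

Lemma adjmx_sum p q (I : finType) (A : I -> 'M[C]_(p, q)) :
  adjmx (\sum_i A i) = \sum_i adjmx (A i).
Proof. exact: (big_morph _ (@adjmxD p q) (@adjmx0 p q)). Qed.

Lemma mxtrace_adj p (A : 'M[C]_p) : \tr (adjmx A) = (\tr A)^*.
Proof. by rewrite /adjmx trace_map_mx mxtrace_tr. Qed.

Lemma adjmx_cV_ge0 p (v : 'cV[C]_p) : 0 <= (adjmx v *m v) ord0 ord0.
Proof. by rewrite mxE sumr_ge0// => i _; rewrite !mxE mulrC mul_conjC_ge0. Qed.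

Lemma psdmx_gram p q (A : 'M[C]_(p, q)) : psdmx (adjmx A *m A).
Proof.
split=> [|v]; first by rewrite adjmxM adjmxK.
by rewrite mulmxA -mulmxA -adjmxM adjmx_cV_ge0.
Qed.

Lemma psdmx_gramr p q (A : 'M[C]_(p, q)) : psdmx (A *m adjmx A).
Proof. by rewrite -[A in A *m _]adjmxK; exact: psdmx_gram. Qed.

Lemma psdmx_conj p q (A : 'M[C]_p) (B : 'M[C]_(p, q)) :
  psdmx A -> psdmx (adjmx B *m A *m B).
Proof.
move=> [hA pA]; split=> [|v]; first by rewrite !adjmxM adjmxK hA mulmxA.
by rewrite !mulmxA -adjmxM -mulmxA pA.
Qed.

Lemma psdmx_conjr p q (A : 'M[C]_p) (B : 'M[C]_(q, p)) :
  psdmx A -> psdmx (B *m A *m adjmx B).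
Proof. by move=> /(@psdmx_conj _ _ _ (adjmx B)); rewrite adjmxK. Qed.

Lemma psdmxD p (A B : 'M[C]_p) : psdmx A -> psdmx B -> psdmx (A + B).
Proof.
move=> [hA pA] [hB pB]; split=> [|v]; first by rewrite adjmxD hA hB.
by rewrite mulmxDr mulmxDl mxE addr_ge0.
Qed.

Lemma psdmx0 p : psdmx (0 : 'M[C]_p).
Proof. by split=> [|v]; rewrite ?adjmx0// mulmx0 mul0mx mxE. Qed.

Lemma psdmx_sum p (I : finType) (A : I -> 'M[C]_p) :
  (forall i, psdmx (A i)) -> psdmx (\sum_i A i).
Proof.
by move=> pA; elim/big_ind: _ => //; [exact: psdmx0 | exact: psdmxD].
Qed.

Lemma psdmxZ p a (A : 'M[C]_p) : 0 <= a -> psdmx A -> psdmx (a *: A).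
Proof.
move=> a0 [hA pA]; split=> [|v].
  by rewrite adjmxZ hA (CrealP (ger0_real a0)).
by rewrite -scalemxAr -scalemxAl mxE mulr_ge0.
Qed.

Lemma psdmx_proj p (E : 'M[C]_p) : adjmx E = E -> E *m E = E -> psdmx E.
Proof. by move=> hE EE; rewrite -EE -{1}hE; exact: psdmx_gram. Qed.

Lemma psdmx_proj_compl p (E : 'M[C]_p) :
  adjmx E = E -> E *m E = E -> psdmx (1%:M - E).
Proof.
move=> hE EE; apply: psdmx_proj; first by rewrite adjmxD adjmxN adjmx1 hE.
by rewrite mulmxBl mul1mx mulmxBr mulmx1 EE subrr subr0.
Qed.

Lemma psdmx_diag_ge0 p (A : 'M[C]_p) i : psdmx A -> 0 <= A i i.
Proof.
move=> [_ /(_ (delta_mx i 0))].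
pose e : 'cV[C]_p := delta_mx i 0.
suff -> : (adjmx e *m A *m e) ord0 ord0 = A i i by [].
by rewrite /adjmx /e trmx_delta map_delta_mx -rowE -colE !mxE.
Qed.

Lemma mxtrace_psd_ge0 p (A : 'M[C]_p) : psdmx A -> 0 <= \tr A.
Proof. by move=> pA; rewrite sumr_ge0// => i _; exact: psdmx_diag_ge0. Qed.

(** * Spectral decomposition, square roots and pseudo-inverses *)

Lemma hermitian_spectral p (A : 'M[C]_p) : adjmx A = A ->
  exists (U : 'M[C]_p) (d : 'rV[C]_p),
    [/\ U *m adjmx U = 1%:M, adjmx U *m U = 1%:M &
        A = adjmx U *m diag_mx d *m U].
Proof.
move=> hA; have nA : A \is normalmx.
  by apply/normalmxP; rewrite -[map_mx _ _]/(adjmx A) hA.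
have /unitarymxP UU := spectral_unitarymx A.
exists (spectralmx A), (spectral_diag A); split=> //; first exact: mulmx1C.
have := orthomx_spectralP nA.
by rewrite invmx_unitary ?spectral_unitarymx.
Qed.

Lemma psdmx_spectral p (A : 'M[C]_p) : psdmx A ->
  exists (U : 'M[C]_p) (d : 'rV[C]_p),
    [/\ U *m adjmx U = 1%:M, adjmx U *m U = 1%:M,
        A = adjmx U *m diag_mx d *m U & forall i, 0 <= d 0 i].
Proof.
move=> psdA; have [hA _] := psdA.
have [U [d [UU U'U AE]]] := hermitian_spectral hA.
exists U, d; split=> // i.
have dE : diag_mx d = U *m A *m adjmx U.
  by rewrite AE !mulmxA UU mul1mx -!mulmxA UU mulmx1.
have -> : d 0 i = (diag_mx d) i i by rewrite mxE eqxx mulr1n.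
by apply: psdmx_diag_ge0; rewrite dE; exact: psdmx_conjr.
Qed.

Lemma psdmx_diag p (d : 'rV[C]_p) : (forall i, 0 <= d 0 i) -> psdmx (diag_mx d).
Proof.
move=> d0; split.
  apply/matrixP=> i j; rewrite !mxE eq_sym; case: eqVneq => [->|_].
    by rewrite mulr1n (CrealP (ger0_real _)).
  by rewrite mulr0n rmorph0.
move=> v; rewrite mxE sumr_ge0// => i _; rewrite mul_mx_diag !mxE mulrAC.
by rewrite mulr_ge0// mulrC mul_conjC_ge0.
Qed.

Lemma psdmx_sqrt_exists p (A : 'M[C]_p) :
  psdmx A -> exists B, psdmx B /\ B *m B = A.
Proof.
move=> /psdmx_spectral[U [d [UU U'U -> d0]]].
exists (adjmx U *m diag_mx (map_mx sqrtC d) *m U); split.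
  by apply/psdmx_conj/psdmx_diag => i; rewrite mxE sqrtC_ge0.
rewrite !mulmxA -[_ *m U *m adjmx U]mulmxA UU mulmx1 -[_ *m diag_mx _ *m diag_mx _]mulmxA.
rewrite mulmx_diag; congr (_ *m diag_mx _ *m _).
by apply/rowP=> i; rewrite !mxE -expr2 sqrtCK.
Qed.

(** With X = A - B, the anticommutator of X and A + B is 2 (A A - B B) = 0. In an eigenbasis of X
    its diagonal reads d_i (A + B)_ii = 0; if the second factor vanishes, so do both nonnegative
    entries A_ii and B_ii, and d_i is their difference. *)
Lemma psdmx_sqrt_unique p (A B : 'M[C]_p) :
  psdmx A -> psdmx B -> A *m A = B *m B -> A = B.
Proof.
move=> pA pB AB.
have hX : adjmx (A - B) = A - B by rewrite adjmxD adjmxN pA.1 pB.1.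
have [U [d [UU U'U XE]]] := hermitian_spectral hX.
pose cj M := U *m M *m adjmx U.
have cjM M1 M2 : cj (M1 *m M2) = cj M1 *m cj M2.
  by rewrite /cj !mulmxA -[_ *m adjmx U *m U]mulmxA U'U mulmx1.
have dE : diag_mx d = cj A - cj B.
  rewrite /cj -mulmxBl -mulmxBr XE !mulmxA UU mul1mx -!mulmxA UU mulmx1 //.
have anti : diag_mx d *m (cj A + cj B) + (cj A + cj B) *m diag_mx d = 0.
  rewrite dE mulmxBl mulmxBr !mulmxDl !mulmxDr -!cjM AB.
  by rewrite [X in _ + (X - _)]addrC [X in _ + (_ - X)]addrC subrKA subrr.
have d0 i : d 0 i = 0.
  have diE (S : 'M[C]_p) :
      (diag_mx d *m S + S *m diag_mx d) i i = (d 0 i * S i i) *+ 2.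
    by rewrite mul_mx_diag mul_diag_mx !mxE [_ * d 0 i]mulrC.
  have /matrixP/(_ i i)/eqP := anti.
  rewrite diE [X in _ == X]mxE mulrn_eq0 /= mulf_eq0 => /orP[/eqP//|].
  have cA : 0 <= (cj A) i i by apply/psdmx_diag_ge0/psdmx_conjr.
  have cB : 0 <= (cj B) i i by apply/psdmx_diag_ge0/psdmx_conjr.
  rewrite mxE paddr_eq0// => /andP[/eqP cA0 /eqP cB0].
  have /matrixP/(_ i i) := dE.
  by rewrite [RHS]mxE [X in _ + X]mxE cA0 cB0 subrr mxE eqxx mulr1n.
apply/eqP; rewrite -subr_eq0 XE.
have -> : d = 0 by apply/rowP=> i; rewrite d0 mxE.
by rewrite linear0 mulmx0 mul0mx.
Qed.

Lemma sqrtmxP p (A : 'M[C]_p) :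
  psdmx A -> psdmx (sqrtmx A) /\ sqrtmx A *m sqrtmx A = A.
Proof. by move=> /psdmx_sqrt_exists; exact: ClassicalEpsilon.epsilon_spec. Qed.

Lemma sqrtmx_unique p (A B : 'M[C]_p) : psdmx B -> B *m B = A -> sqrtmx A = B.
Proof.
move=> pB BB; have pA : psdmx A by rewrite -BB -{1}pB.1; exact: psdmx_gram.
have [pS SS] := sqrtmxP pA.
by apply: psdmx_sqrt_unique; rewrite // SS.
Qed.

Lemma psdmx_pinv p (A : 'M[C]_p) : psdmx A -> exists P : 'M[C]_p,
  [/\ adjmx P = P, A *m P = P *m A, A *m P *m A = A & P *m A *m P = P].
Proof.
move=> /psdmx_spectral[U [d [UU U'U -> d0]]].
(* With the convention [0^-1 = 0], inverting the eigenvalues gives the Moore-Penrose inverse. *)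
pose f := map_mx (fun x : C => x^-1) d.
have cjM (M1 M2 : 'M[C]_p) : (adjmx U *m M1 *m U) *m (adjmx U *m M2 *m U)
    = adjmx U *m (M1 *m M2) *m U.
  by rewrite !mulmxA -[_ *m U *m adjmx U]mulmxA UU mulmx1.
exists (adjmx U *m diag_mx f *m U); rewrite !cjM !mulmx_diag; split.
- rewrite !adjmxM adjmxK mulmxA (psdmx_diag _).1 // => i.
  by rewrite mxE invr_ge0.
- congr (_ *m diag_mx _ *m _); apply/rowP=> i; rewrite !mxE; exact: mulrC.
- congr (_ *m diag_mx _ *m _); apply/rowP=> i; rewrite !mxE.
  by have [->|dN0] := eqVneq (d 0 i) 0; rewrite ?mulr0 ?divfK.
- congr (_ *m diag_mx _ *m _); apply/rowP=> i; rewrite !mxE.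
  by have [->|dN0] := eqVneq (d 0 i) 0; rewrite ?invr0 ?mulr0 ?mulVKf ?mulVf ?mul1r.
Qed.

(** * Trace inequalities and the polar decomposition *)

Lemma mxtrace_gram p q (A : 'M[C]_(p, q)) :
  \tr (adjmx A *m A) = \sum_j \sum_i `|A i j| ^+ 2.
Proof.
apply: eq_bigr => j _; rewrite mxE; apply: eq_bigr => i _.
by rewrite !mxE mulrC normCK.
Qed.

Lemma mxtrace_gram_eq0 p q (A : 'M[C]_(p, q)) : \tr (adjmx A *m A) = 0 -> A = 0.
Proof.
rewrite mxtrace_gram => /eqP; rewrite psumr_eq0 => [|j _]; last first.
  by apply: sumr_ge0 => i _; rewrite exprn_ge0.
move=> /allP A0; apply/matrixP=> i j; rewrite mxE; apply/eqP.
have := A0 j; rewrite mem_index_enum psumr_eq0 => [/(_ isT)/allP/(_ i)|k _].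
  by rewrite mem_index_enum => /(_ isT) /=; rewrite sqrf_eq0 normr_eq0.
by rewrite exprn_ge0.
Qed.

Lemma mxtrace_mul_psd_ge0 p (A B : 'M[C]_p) :
  psdmx A -> psdmx B -> 0 <= \tr (A *m B).
Proof.
move=> pA /sqrtmxP[[hS _] <-]; rewrite mulmxA mxtrace_mulC mulmxA -{1}hS.
exact/mxtrace_psd_ge0/psdmx_conj.
Qed.

Lemma mxtrace_mul_le p (A B : 'M[C]_p) :
  psdmx A -> psdmx (1%:M - B) -> \tr (A *m B) <= \tr A.
Proof.
move=> pA pB; rewrite -subr_ge0 -raddfB /=.
by rewrite -[X in X - _]mulmx1 -mulmxBr mxtrace_mul_psd_ge0.
Qed.

(** Expands the squared Hilbert-Schmidt norm of X - Y. The left-hand side is twice the real part of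
    the inner product; with a suitable scaling of X this plays the part of Cauchy-Schwarz. *)
Lemma mxtrace_AMGM p q (X Y : 'M[C]_(p, q)) :
  \tr (adjmx X *m Y) + (\tr (adjmx X *m Y))^* <=
  \tr (adjmx X *m X) + \tr (adjmx Y *m Y).
Proof.
have := mxtrace_psd_ge0 (psdmx_gram (X - Y)).
suff -> : \tr (adjmx (X - Y) *m (X - Y)) =
    \tr (adjmx X *m X) + \tr (adjmx Y *m Y) -
    (\tr (adjmx X *m Y) + (\tr (adjmx X *m Y))^* ) by rewrite subr_ge0.
rewrite -mxtrace_adj adjmxM adjmxK adjmxD adjmxN mulmxBl !mulmxBr.
by rewrite !raddfB /= opprK [- _ + _]addrC opprD addrACA.
Qed.

(** The factor W = Q G, with Q the pseudo-inverse of P, is a partial isometry: both of its Gram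
    matrices are projections, hence at most 1, even when G is rectangular or singular. *)
Lemma polar_decomposition p q (G : 'M[C]_(p, q)) (P := sqrtmx (G *m adjmx G)) :
  exists W : 'M[C]_(p, q),
    [/\ P *m W = G, G *m adjmx W = P, psdmx (1%:M - W *m adjmx W) &
        psdmx (1%:M - adjmx W *m W)].
Proof.
have [pP PP] := sqrtmxP (psdmx_gramr G); rewrite -/P in pP PP.
have [Q [hQ PQ PQP QPQ]] := psdmx_pinv pP.
(* P Q is the projection onto the range of P, which contains that of G: the Gram matrix of (1 - P Q)
   G contains the factor (1 - P Q) P = 0. *)
have QPG : P *m Q *m G = G.
  have Z0 : adjmx ((1%:M - P *m Q) *m G) = 0.
    apply: mxtrace_gram_eq0; rewrite adjmxK adjmxM.
    rewrite mulmxA -[_ *m G *m _]mulmxA -PP mulmxA mulmxBl mul1mx PQP subrr.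
    by rewrite !mul0mx mxtrace0.
  apply/eqP; rewrite eq_sym -subr_eq0 -{1}[G]mul1mx -mulmxBl.
  by rewrite -[X in X == _]adjmxK Z0 adjmx0.
have WW : (Q *m G) *m adjmx (Q *m G) = P *m Q.
  rewrite adjmxM hQ mulmxA -[Q *m G *m _]mulmxA -PP mulmxA -PQ PQP.
  by [].
have GW : G *m adjmx (Q *m G) = P.
  by rewrite adjmxM hQ mulmxA -PP -mulmxA PQ mulmxA PQP.
exists (Q *m G); split=> //; first by rewrite mulmxA.
  rewrite WW; apply: psdmx_proj_compl; first by rewrite adjmxM hQ pP.1 PQ.
  by rewrite mulmxA PQP.
apply: psdmx_proj_compl; first by rewrite adjmxM adjmxK.
rewrite mulmxA -[adjmx _ *m _ *m adjmx _]mulmxA WW.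
by rewrite -!mulmxA [P *m (Q *m _)]mulmxA [P *m Q *m _]mulmxA PQ QPQ.
Qed.

(** The trace norm dominates the pairing with any contraction. Splitting P as R R, the inequality
    above is applied to R and R W V, whose squared norms are each at most tr P. *)
Lemma mxtrace_le_sqrt_gram p q (G : 'M[C]_(p, q)) (V : 'M[C]_(q, p)) :
  psdmx (1%:M - V *m adjmx V) ->
  \tr (G *m V) + (\tr (G *m V))^* <= \tr (sqrtmx (G *m adjmx G)) *+ 2.
Proof.
move=> pV; have [W [PW GW WW _]] := polar_decomposition G.
have [pP _] := sqrtmxP (psdmx_gramr G); move: pP PW GW.
set P := sqrtmx _ => pP PW GW.
have [[hR pR] RR] := sqrtmxP pP; set R := sqrtmx P in hR pR RR.
have -> : G *m V = adjmx R *m (R *m W *m V) by rewrite hR !mulmxA RR PW.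
apply: le_trans (mxtrace_AMGM _ _) _; rewrite mulr2n hR RR lerD2l.
rewrite mxtrace_mulC !adjmxM hR !mulmxA.
have -> : R *m W *m V *m adjmx V *m adjmx W *m R =
    R *m W *m (V *m adjmx V) *m adjmx (R *m W) by rewrite adjmxM hR !mulmxA.
have le1 : \tr (R *m W *m (V *m adjmx V) *m adjmx (R *m W)) <=
    \tr (R *m W *m adjmx (R *m W)).
  rewrite -subr_ge0 -raddfB /= -mulmxBl -{1}[R *m W]mulmx1 -mulmxBr.
  exact/mxtrace_psd_ge0/psdmx_conjr.
apply: le_trans le1 _; rewrite adjmxM hR mulmxA mxtrace_mulC !mulmxA RR -mulmxA.
exact: mxtrace_mul_le.
Qed.

End PositiveMatrices.

(** * Fidelity and success probability *)

Section Fidelity.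
Variables (C : numClosedFieldType) (n m : nat).

(** The isometry |i> tensor 1 from C^m into C^n tensor C^m; block matrices are handled through these
    maps instead of indices. *)
Definition block_inj (i : 'I_n) : 'M[C]_(n * m, m) :=
  \matrix_(k, a) (k == mxvec_index i a)%:R.
Local Notation E := block_inj.

Lemma mxvec_index_eq (i j : 'I_n) (a b : 'I_m) :
  (mxvec_index i a == mxvec_index j b) = (i == j) && (a == b).
Proof. by rewrite (inj_eq (@cast_ord_inj _ _ _)) (inj_eq enum_rank_inj). Qed.

Lemma block_inj_adj i j : adjmx (E i) *m E j = if i == j then 1%:M else 0.
Proof.
apply/matrixP=> a b; rewrite mxE (bigD1 (mxvec_index i a))//= big1 => [|k ka].
  rewrite !mxE eqxx conjC1 mul1r addr0 mxvec_index_eq.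
  by case: eqP; rewrite ?mxE.
by rewrite !mxE (negPf ka) rmorph0 mul0r.
Qed.

Lemma block_inj_sum : \sum_i E i *m adjmx (E i) = 1%:M.
Proof.
apply/matrixP=> k l; case/mxvec_indexP: k => i a; case/mxvec_indexP: l => j b.
rewrite summxE (bigD1 i)//= big1 => [|i' i'i].
  rewrite addr0 mxE (bigD1 a)//= big1 => [|a' a'a].
    by rewrite addr0 !mxE eqxx mul1r conjC_nat [in LHS]eq_sym.
  by rewrite !mxE mxvec_index_eq [a == a']eq_sym (negPf a'a) andbF mul0r.
rewrite mxE big1 // => a' _.
by rewrite !mxE mxvec_index_eq [i == i']eq_sym (negPf i'i) mul0r.
Qed.

Lemma kronmx_ketbra i j (X : 'M[C]_m) :
  kronmx (ketbra C i j) X = E i *m X *m adjmx (E j).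
Proof.
apply/matrixP=> k l; case/mxvec_indexP: k => k a; case/mxvec_indexP: l => l b.
rewrite mxE (bigD1 k)//= [X in _ + X]big1 ?addr0 => [|k' k'k]; last first.
  rewrite big1 // => a' _; rewrite big1 // => j' _; rewrite big1 // => b' _.
  by rewrite mxvec_index_eq [k == k']eq_sym (negPf k'k).
rewrite (bigD1 a)//= [X in _ + X]big1 ?addr0 => [|a' a'a]; last first.
  rewrite big1 // => j' _; rewrite big1 // => b' _.
  by rewrite mxvec_index_eq [a == a']eq_sym (negPf a'a) andbF.
rewrite (bigD1 l)//= [X in _ + X]big1 ?addr0 => [|l' l'l]; last first.
  rewrite big1 // => b' _.
  by rewrite !mxvec_index_eq [l == l']eq_sym (negPf l'l) andbF.
rewrite (bigD1 b)//= [X in _ + X]big1 ?addr0 => [|b' b'b]; last first.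
  by rewrite !mxvec_index_eq [b == b']eq_sym (negPf b'b) !andbF.
rewrite !eqxx /= mxE.
rewrite mxE (bigD1 b)//= [X in _ + X]big1 ?addr0 => [|b' b'b]; last first.
  by rewrite !mxE mxvec_index_eq [b == b']eq_sym (negPf b'b) andbF rmorph0 mulr0.
rewrite mxE (bigD1 a)//= [X in _ + X]big1 ?addr0 => [|a' a'a]; last first.
  by rewrite !mxE mxvec_index_eq [a == a']eq_sym (negPf a'a) andbF mul0r.
rewrite !mxE !mxvec_index_eq !eqxx !andbT conjC_nat [_ * X a b]mulrC.
by case: eqP => _; case: eqP => _; rewrite ?(mulr0, mul0r, mulr1, mul1r).
Qed.

Lemma block_diagM (X : 'I_n -> 'M[C]_m) q (Y : 'I_n -> 'M[C]_(m, q)) :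
  (\sum_i E i *m X i *m adjmx (E i)) *m (\sum_i E i *m Y i) =
  \sum_i E i *m (X i *m Y i).
Proof.
rewrite mulmx_suml; apply: eq_bigr => i _.
rewrite mulmx_sumr (bigD1 i)//= big1 => [|j ji].
  rewrite addr0 !mulmxA -[_ *m adjmx (E i) *m E i]mulmxA block_inj_adj eqxx.
  by rewrite mulmx1.
by rewrite !mulmxA -[_ *m adjmx (E i) *m E j]mulmxA block_inj_adj eq_sym
  (negPf ji) mulmx0 mul0mx.
Qed.

Lemma sqrtmx_block_diag (T : 'I_n -> 'M[C]_m) : (forall i, psdmx (T i)) ->
  sqrtmx (\sum_i E i *m (T i *m T i) *m adjmx (E i)) =
  \sum_i E i *m T i *m adjmx (E i).
Proof.
move=> pT; apply: sqrtmx_unique.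
  by apply: psdmx_sum => i; exact: psdmx_conjr.
under [X in _ *m X]eq_bigr do rewrite -mulmxA.
by rewrite block_diagM; apply: eq_bigr => i _; rewrite !mulmxA.
Qed.

(** Turns the fidelity into a trace norm, to which the polar decomposition applies. *)
Lemma fidelity_gram k q (A : 'M[C]_(k, q)) (sigma : 'M[C]_k) : psdmx sigma ->
  fidelity (A *m adjmx A) sigma =
  \tr (sqrtmx ((sqrtmx sigma *m A) *m adjmx (sqrtmx sigma *m A))).
Proof. by move=> /sqrtmxP[[hS _] _]; rewrite /fidelity adjmxM hS !mulmxA. Qed.

Variables (rho : 'I_n -> 'M[C]_m) (eta : 'I_n -> C).
Hypothesis rho_density : forall i, density (rho i).
Hypothesis eta_ge0 : forall i, 0 <= eta i.

Local Notation S i := (sqrtmx (eta i *: rho i)).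
Local Notation A := (\sum_i E i *m S i).

Lemma sqrt_state i : psdmx (S i) /\ S i *m S i = eta i *: rho i.
Proof. exact/sqrtmxP/psdmxZ/(rho_density i).1. Qed.

Lemma qsd_state_gram : qsd_state rho eta = A *m adjmx A.
Proof.
rewrite /qsd_state adjmx_sum mulmx_suml; apply: eq_bigr => i _.
rewrite mulmx_sumr; apply: eq_bigr => j _.
by rewrite kronmx_ketbra adjmxM (sqrt_state j).1.1 !mulmxA.
Qed.

Lemma succ_probE (M : 'I_n -> 'M[C]_m) :
  succ_prob rho eta M = \sum_i \tr (M i *m (S i *m S i)).
Proof.
by apply: eq_bigr => i _; rewrite (sqrt_state i).2 -scalemxAr mxtraceZ.
Qed.

Lemma mxtrace_block (D : 'I_n -> 'M[C]_m) (V : 'M[C]_(m, n * m)) :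
  \tr ((\sum_i E i *m D i) *m V) = \sum_i \tr (D i *m (V *m E i)).
Proof.
rewrite mulmx_suml raddf_sum /=; apply: eq_bigr => i _.
by rewrite -mulmxA mxtrace_mulC mulmxA.
Qed.

Lemma fidelity_le_succ_prob sigma : partial_incoherent sigma ->
  exists2 M, povm M & fidelity (qsd_state rho eta) sigma ^+ 2 <= succ_prob rho eta M.
Proof.
move=> [p [s [[p0 p1] [ds sE]]]].
have psd_ps i : psdmx (p i *: s i) by exact/psdmxZ/(ds i).1.
have Rp i := sqrtmxP (psd_ps i); set R := fun i => sqrtmx (p i *: s i) in Rp.
have sigmaE : sigma = \sum_i E i *m (R i *m R i) *m adjmx (E i).
  by rewrite sE; apply: eq_bigr => i _; rewrite kronmx_ketbra (Rp i).2.
have psd_sigma : psdmx sigma.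
  rewrite sigmaE; apply: psdmx_sum => i; apply: psdmx_conjr.
  by rewrite (Rp i).2.
have sqrt_sigma : sqrtmx sigma = \sum_i E i *m R i *m adjmx (E i).
  by rewrite sigmaE sqrtmx_block_diag// => i; exact: (Rp i).1.
rewrite qsd_state_gram fidelity_gram// sqrt_sigma block_diagM.
set G := \sum_i _; have [W [_ GW _ W1]] := polar_decomposition G.
set l := \tr _; have l0 : 0 <= l by exact/mxtrace_psd_ge0/(sqrtmxP (psdmx_gramr G)).1.
(* The blocks of the adjoint of W: they split the trace norm [l] into one term per state and will
   give the effects of the POVM. *)
pose V i := adjmx W *m E i.
have lE : l = \sum_i \tr (R i *m (S i *m V i)).
  by rewrite /l -GW mxtrace_block; apply: eq_bigr => i _; rewrite /V !mulmxA.
have VE : \sum_i V i *m adjmx (V i) = adjmx W *m W.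
  under eq_bigr do rewrite /V adjmxM adjmxK mulmxA -[_ *m E _ *m _]mulmxA.
  by rewrite -mulmx_suml -mulmx_sumr block_inj_sum mulmx1.
have le_l : l ^+ 2 <= \sum_i \tr (V i *m adjmx (V i) *m (S i *m S i)).
  (* Scaling R_i by [l] is the optimal choice: summing over i gives 2 l^2 on the left, and l^2 plus
     the success probability on the right. *)
  have amgm i : l * \tr (R i *m (S i *m V i)) + l * (\tr (R i *m (S i *m V i)))^*
      <= l ^+ 2 * p i + \tr (V i *m adjmx (V i) *m (S i *m S i)).
    have := mxtrace_AMGM (l *: R i) (S i *m V i).
    have lR : l^* = l by rewrite (CrealP (ger0_real l0)).
    rewrite adjmxZ (Rp i).1.1 lR -scalemxAl mxtraceZ rmorphM /= lR.
    rewrite -scalemxAl -scalemxAr !mxtraceZ (Rp i).2 mxtraceZ (ds i).2 mulr1.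
    rewrite adjmxM (sqrt_state i).1.1 mulrA -expr2 => /le_trans-> //.
    by rewrite lerD2l [leRHS]mxtrace_mulC !mulmxA [leRHS]mxtrace_mulC !mulmxA.
  have := ler_sum (index_enum _) (fun i (_ : true) => amgm i).
  rewrite !big_split /= -!mulr_sumr -rmorph_sum /= -lE p1 mulr1.
  by rewrite (CrealP (ger0_real l0)) -expr2 lerD2l.
have [i0 _] : exists i : 'I_n, true.
  case: (pickP (fun _ : 'I_n => true)) => [i _|no_i]; first by exists i.
  by move: p1 => /eqP; rewrite big_pred0// eq_sym oner_eq0.
(* The V_i only give a sub-POVM; the positive defect is added to one effect, which cannot lower the
   success probability. *)
pose rest i : 'M[C]_m := if i == i0 then 1%:M - adjmx W *m W else 0.
have rest0 i : psdmx (rest i) by rewrite /rest; case: ifP => _ //; exact: psdmx0.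
exists (fun i => V i *m adjmx (V i) + rest i).
  split=> [i|]; first by apply: psdmxD => //; exact: psdmx_gramr.
  rewrite big_split /= VE (bigD1 i0)//= big1 => [|i ii0].
    by rewrite /rest eqxx addr0 addrC subrK.
  by rewrite /rest (negPf ii0).
apply: le_trans le_l _; rewrite succ_probE; apply: ler_sum => i _.
rewrite mulmxDl raddfD /= lerDl mxtrace_mul_psd_ge0//.
by rewrite (sqrt_state i).2; exact/psdmxZ/(rho_density i).1.
Qed.

(** [sigma] is chosen with square root the block diagonal of the T_i / sqrt s, where T_i is the
    positive polar factor of S_i sqrt(M_i); pairing with the contraction formed by the V_i shows
    that the fidelity is at least sqrt s. *)
Lemma succ_prob_le_fidelity M : povm M -> 0 < succ_prob rho eta M ->
  exists2 sigma, partial_incoherent sigma &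
    succ_prob rho eta M <= fidelity (qsd_state rho eta) sigma ^+ 2.
Proof.
move=> [pM M1] s_gt0; set s := succ_prob _ _ _ in s_gt0 *.
have Np i := sqrtmxP (pM i); pose N i := sqrtmx (M i).
pose G i := S i *m N i; pose T i := sqrtmx (G i *m adjmx (G i)).
(* V_i is sqrt(M_i) times the adjoint of the polar factor W of G_i: it makes S_i V_i positive and
   stays below M_i because W is a contraction. *)
have /fin_all_exists[V VP] i : exists Vi : 'M[C]_m,
    S i *m Vi = T i /\ psdmx (M i - Vi *m adjmx Vi).
  have [W [_ GW _ W1]] := polar_decomposition (G i).
  exists (N i *m adjmx W); split; first by rewrite mulmxA.
  rewrite -[M i](Np i).2 adjmxM adjmxK (Np i).1.1 mulmxA -[N i *m _ *m W]mulmxA.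
  rewrite -{1}[sqrtmx (M i)]mulmx1 -mulmxBl -mulmxBr -{2}[sqrtmx _](Np i).1.1.
  exact: psdmx_conjr.
have Tp i : psdmx (T i) /\ T i *m T i = G i *m adjmx (G i).
  exact/sqrtmxP/psdmx_gramr.
pose t i := \tr (T i *m T i).
have t0 i : 0 <= t i by rewrite /t -{1}(Tp i).1.1; exact/mxtrace_psd_ge0/psdmx_gram.
have st : s = \sum_i t i.
  rewrite /s succ_probE; apply: eq_bigr => i _.
  rewrite /t (Tp i).2 /G adjmxM (Np i).1.1 (sqrt_state i).1.1 !mulmxA.
  by rewrite [RHS]mxtrace_mulC -(mulmxA (S i)) (Np i).2 mulmxA mxtrace_mulC !mulmxA.
have sN0 : s != 0 by rewrite gt_eqF.
pose r := sqrtC s; have r0 : 0 < r by rewrite sqrtC_gt0.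
have rr : r * r = s by rewrite -expr2 sqrtCK.
pose D i := r^-1 *: T i.
have Dp i : psdmx (D i) by apply: psdmxZ (Tp i).1; rewrite invr_ge0 ltW.
(* If t_i = 0 then T_i = 0 and the block has weight zero; [rho i] merely fills in a density
   matrix. *)
pose sg i := if t i == 0 then rho i else (t i)^-1 *: (T i *m T i).
have DE i : D i *m D i = (t i / s) *: sg i.
  rewrite /D -scalemxAl -scalemxAr scalerA -invfM rr /sg.
  case: eqVneq => [ti0|tiN0]; last by rewrite scalerA mulrAC divff// mul1r.
  have -> : T i = 0 by apply: mxtrace_gram_eq0; rewrite (Tp i).1.1.
  by rewrite mulmx0 scaler0 ti0 mul0r scale0r.
pose sigma : 'M[C]_(n * m) := \sum_i E i *m (D i *m D i) *m adjmx (E i).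
exists sigma.
  exists (fun i => t i / s), sg; split; [split|split].
  - by move=> i; rewrite divr_ge0// ltW.
  - by rewrite -mulr_suml -st divff.
  - move=> i; rewrite /sg; case: eqVneq => [//|tiN0]; split.
      apply: psdmxZ; first by rewrite invr_ge0.
      by rewrite -{1}(Tp i).1.1; exact: psdmx_gram.
    by rewrite mxtraceZ mulVf.
  - by apply: eq_bigr => i _; rewrite kronmx_ketbra DE.
have psd_sigma : psdmx sigma.
  apply: psdmx_sum => i; apply: psdmx_conjr.
  by rewrite -{1}(Dp i).1; exact: psdmx_gram.
rewrite qsd_state_gram fidelity_gram// sqrtmx_block_diag// block_diagM.
(* [VV] is the block row of the V_i; it is a contraction since the V_i V_i^* sum to at most the sum
   of the M_i, which is 1. *)
set K := \sum_i _; pose VV := \sum_i V i *m adjmx (E i).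
have VVE i : VV *m E i = V i.
  rewrite mulmx_suml (bigD1 i)//= big1 => [|j ji].
    by rewrite addr0 -mulmxA block_inj_adj eqxx mulmx1.
  by rewrite -mulmxA block_inj_adj (negPf ji) mulmx0.
have VV1 : psdmx (1%:M - VV *m adjmx VV).
  have -> : VV *m adjmx VV = \sum_i V i *m adjmx (V i).
    rewrite {2}/VV adjmx_sum mulmx_sumr; apply: eq_bigr => i _.
    by rewrite adjmxM adjmxK mulmxA VVE.
  by rewrite -M1 -sumrB; apply: psdmx_sum => i; exact: (VP i).2.
have := mxtrace_le_sqrt_gram K VV1; rewrite mxtrace_block.
have -> : \sum_i \tr (D i *m S i *m (VV *m E i)) = r.
  transitivity (\sum_i r^-1 * t i).
    apply: eq_bigr => i _; rewrite VVE -mulmxA (VP i).1 /D -scalemxAl.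
    by rewrite mxtraceZ.
  by rewrite -mulr_sumr -st -rr mulKf// gt_eqF.
rewrite (CrealP (gtr0_real r0)) -mulr2n lerMn2r /= -rr => rl.
by rewrite expr2 ler_pM// ltW.
Qed.

End Fidelity.

(** * Optimal measurements *)

Section OptimalPovm.
Variable C : numClosedFieldType.
Local Notation R := (creal C).

(** Since the variables are real, conjugation preserves this class, so adjoints of polynomial
    matrices are again polynomial. *)
Definition cpolyfun N (h : N.-tuple R -> C) : Prop :=
  exists u v, [/\ polyfun u, polyfun v &
    forall x, h x = creal_val (u x) + 'i * creal_val (v x)].

Lemma eq_cpolyfun N (g h : N.-tuple R -> C) : g =1 h -> cpolyfun g -> cpolyfun h.
Proof. by move=> gh [u [v [pu pv E]]]; exists u, v; split=> // x; rewrite -gh. Qed.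

Lemma cpolyfun_cst N c : cpolyfun (fun _ : N.-tuple R => c).
Proof.
exists (fun=> in_creal (Creal_Re c)), (fun=> in_creal (Creal_Im c)).
by split=> [||_]; [exact: polyfun_cst | exact: polyfun_cst | exact: Crect].
Qed.

Lemma cpolyfunD N (g h : N.-tuple R -> C) :
  cpolyfun g -> cpolyfun h -> cpolyfun (fun x => g x + h x).
Proof.
move=> [u [v [pu pv E]]] [u' [v' [pu' pv' E']]].
exists (fun x => u x + u' x), (fun x => v x + v' x).
split=> [||x]; [exact: polyfunD | exact: polyfunD |].
by rewrite E E' !rmorphD /= mulrDr addrACA.
Qed.

Lemma cpolyfunM N (g h : N.-tuple R -> C) :
  cpolyfun g -> cpolyfun h -> cpolyfun (fun x => g x * h x).
Proof.
move=> [u [v [pu pv E]]] [u' [v' [pu' pv' E']]].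
exists (fun x => u x * u' x + - (v x * v' x)), (fun x => u x * v' x + v x * u' x).
split=> [||x].
- by apply: polyfunD; [exact: polyfunM | apply/polyfunN/polyfunM].
- by apply: polyfunD; exact: polyfunM.
- rewrite E E' !rmorphD !rmorphN !rmorphM /= mulrDl !mulrDr.
  rewrite ['i * _ * ('i * _)]mulrACA -expr2 sqrCi mulN1r.
  by rewrite -!mulrA ['i * _ + - _]addrC addrACA [creal_val (u x) * ('i * _)]mulrCA.
Qed.

Lemma cpolyfun_conj N (h : N.-tuple R -> C) :
  cpolyfun h -> cpolyfun (fun x => (h x)^* ).
Proof.
move=> [u [v [pu pv E]]]; exists u, (fun x => - v x).
split=> [||x]; [by [] | exact: polyfunN |].
rewrite E rmorphD rmorphM /= conjCi !(CrealP (creal_valP _)).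
by rewrite mulNr mulrN.
Qed.

Lemma cpolyfun_sum N (I : finType) (h : I -> N.-tuple R -> C) :
  (forall i, cpolyfun (h i)) -> cpolyfun (fun x => \sum_i h i x).
Proof.
move=> ph; elim: (index_enum I) => [|i s IHs].
  by apply: eq_cpolyfun (cpolyfun_cst _ 0) => x; rewrite big_nil.
by apply: eq_cpolyfun (cpolyfunD (ph i) IHs) => x; rewrite big_cons.
Qed.

Lemma cpolyfun_real N (h : N.-tuple R -> C) :
  (forall x, h x \is Num.real) -> cpolyfun h ->
  exists2 u, polyfun u & forall x, creal_val (u x) = h x.
Proof.
move=> hR [u [v [pu pv E]]]; exists u => // x.
by have := Creal_ReP _ (hR x); rewrite {1}E Re_rect ?creal_valP.
Qed.

Definition cpolymx N p q (X : N.-tuple R -> 'M[C]_(p, q)) : Prop :=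
  forall i j, cpolyfun (fun x => X x i j).

Lemma cpolymxM N p q r (X : N.-tuple R -> 'M[C]_(p, q)) (Y : N.-tuple R -> 'M[C]_(q, r)) :
  cpolymx X -> cpolymx Y -> cpolymx (fun x => X x *m Y x).
Proof.
move=> pX pY i j; apply: eq_cpolyfun (cpolyfun_sum (fun k => cpolyfunM (pX i k) (pY k j))).
by move=> x; rewrite mxE.
Qed.

Lemma cpolymx_adj N p q (X : N.-tuple R -> 'M[C]_(p, q)) :
  cpolymx X -> cpolymx (fun x => adjmx (X x)).
Proof.
move=> pX i j; apply: eq_cpolyfun (cpolyfun_conj (pX j i)) => x.
by rewrite !mxE.
Qed.

Lemma cpolymx_cst N p q (X : 'M[C]_(p, q)) : cpolymx (fun _ : N.-tuple R => X).
Proof. by move=> i j; exact: cpolyfun_cst. Qed.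

Lemma cpolymxD N p q (X Y : N.-tuple R -> 'M[C]_(p, q)) :
  cpolymx X -> cpolymx Y -> cpolymx (fun x => X x + Y x).
Proof.
by move=> pX pY i j; apply: eq_cpolyfun (cpolyfunD (pX i j) (pY i j)) => x; rewrite mxE.
Qed.

Lemma cpolymx_sum N p q (I : finType) (X : I -> N.-tuple R -> 'M[C]_(p, q)) :
  (forall i, cpolymx (X i)) -> cpolymx (fun x => \sum_i X i x).
Proof.
move=> pX i j; apply: eq_cpolyfun (cpolyfun_sum (fun k => pX k i j)) => x.
by rewrite summxE.
Qed.

Lemma cpolyfun_tr N p (X : N.-tuple R -> 'M[C]_p) :
  cpolymx X -> cpolyfun (fun x => \tr (X x)).
Proof. by move=> pX; exact: cpolyfun_sum. Qed.

Variables (n m : nat).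

(* Square roots [B_i] of the effects, [M_i = B_i^* B_i], are parametrised by
   the real and imaginary parts of their entries: POVMs then form the image of
   a bounded real algebraic set. *)
Local Notation coord := ('I_n * 'I_m * 'I_m * bool)%type.
Local Notation N := #|{: coord}|.

Definition effect_root (x : N.-tuple R) (i : 'I_n) : 'M[C]_m :=
  \matrix_(a, b) (creal_val (tnth x (enum_rank (i, a, b, false))) +
    'i * creal_val (tnth x (enum_rank (i, a, b, true)))).

Lemma effect_root_polymx i : cpolymx (fun x => effect_root x i).
Proof.
move=> a b; exists (fun x => tnth x (enum_rank (i, a, b, false))).
exists (fun x => tnth x (enum_rank (i, a, b, true))).
by split=> [||x]; [exact: polyfun_coord | exact: polyfun_coord | rewrite mxE].
Qed.

Lemma effect_root_surj (B : 'I_n -> 'M[C]_m) :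
  exists x, forall i, effect_root x i = B i.
Proof.
pose f (t : coord) : R := let: (i, a, b, im) := t in
  if im then in_creal (Creal_Im (B i a b)) else in_creal (Creal_Re (B i a b)).
exists [tuple f (enum_val k) | k < N] => i; apply/matrixP=> a b.
by rewrite mxE !tnth_mktuple !enum_rankK [RHS]Crect.
Qed.

(** The diagonal entry (b, b) of the sum is the sum of the |B_j c b|^2 over all j and c. This bounds
    the algebraic set of POVM roots. *)
Lemma gram_sum_entry_le1 (B : 'I_n -> 'M[C]_m) i a b :
  \sum_i adjmx (B i) *m B i = 1%:M -> `|B i a b| <= 1.
Proof.
move=> B1; rewrite -(@expr_le1 _ 2)//.
have <- : (\sum_i adjmx (B i) *m B i) b b = 1 by rewrite B1 mxE eqxx.
have gramE j : (adjmx (B j) *m B j) b b = \sum_c `|B j c b| ^+ 2.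
  by rewrite mxE; apply: eq_bigr => c _; rewrite !mxE mulrC normCK.
rewrite summxE (bigD1 i)//= gramE (bigD1 a)//= -addrA lerDl addr_ge0//.
  by apply: sumr_ge0 => c _; rewrite exprn_ge0.
by apply: sumr_ge0 => j _; rewrite gramE sumr_ge0// => c _; rewrite exprn_ge0.
Qed.

Lemma effect_root_le1 x k :
  \sum_i adjmx (effect_root x i) *m effect_root x i = 1%:M -> `|tnth x k| <= 1.
Proof.
rewrite -(enum_valK k); case: (enum_val k) => -[[i a] b] im B1.
have B_le1 : `|effect_root x i a b| <= 1.
  exact: gram_sum_entry_le1 B1.
have le_norm (u v : R) : `|creal_val u + 'i * creal_val v| <= 1 ->
    `|creal_val u| <= 1 /\ `|creal_val v| <= 1.
  move=> uv1; have : `|creal_val u + 'i * creal_val v| ^+ 2 <= 1 by rewrite expr_le1.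
  rewrite normC2_rect ?creal_valP// => uv.
  split; rewrite -(@expr_le1 _ 2)// real_normK ?creal_valP//; apply: le_trans uv.
    by rewrite lerDl real_exprn_even_ge0 ?creal_valP.
  by rewrite lerDr real_exprn_even_ge0 ?creal_valP.
by move: B_le1; rewrite mxE => /le_norm[]; case: im.
Qed.

Lemma povm_point (i0 : 'I_n) :
  povm (fun i => if i == i0 then 1%:M else 0 : 'M[C]_m).
Proof.
split=> [i|]; last first.
  by rewrite (bigD1 i0)//= big1 ?eqxx ?addr0// => i /negPf->.
case: ifP => _; last exact: psdmx0.
by rewrite -[1%:M]mulmx1 -{1}(adjmx1 C m); exact: psdmx_gram.
Qed.

Lemma povm_compl_psd (M : 'I_n -> 'M[C]_m) i : povm M -> psdmx (1%:M - M i).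
Proof.
move=> [pM <-]; rewrite (bigD1 i)//= addrAC subrr add0r.
by elim/big_ind: _ => //; [exact: psdmx0 | exact: psdmxD].
Qed.

Variables (rho : 'I_n -> 'M[C]_m) (eta : 'I_n -> C).
Hypothesis rho_density : forall i, density (rho i).
Hypothesis eta_ge0 : forall i, 0 <= eta i.

Lemma succ_prob_ge0 M : (forall i, psdmx (M i)) -> 0 <= succ_prob rho eta M.
Proof.
move=> pM; apply: sumr_ge0 => i _; rewrite mulr_ge0//.
by apply: mxtrace_mul_psd_ge0 => //; exact: (rho_density i).1.
Qed.

Lemma succ_prob_le M : povm M -> succ_prob rho eta M <= \sum_i eta i.
Proof.
move=> pM; apply: ler_sum => i _; rewrite ler_piMr// mxtrace_mulC.
apply: le_trans (mxtrace_mul_le (rho_density i).1 (povm_compl_psd i pM)) _.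
by rewrite (rho_density i).2.
Qed.

Lemma povm_optimal : (0 < n)%N -> exists2 M, povm M &
  forall M', povm M' -> succ_prob rho eta M' <= succ_prob rho eta M.
Proof.
move=> n_gt0; have eta_sum_ge0 : 0 <= \sum_i eta i by exact: sumr_ge0.
pose effect x i := adjmx (effect_root x i) *m effect_root x i.
have effectp x i : psdmx (effect x i) by exact: psdmx_gram.
have peffect i : cpolymx (fun x => effect x i).
  by apply: cpolymxM; [apply: cpolymx_adj |]; exact: effect_root_polymx.
pose D x := \sum_i effect x i + - 1%:M.
have pD : cpolymx D.
  by apply: cpolymxD; [exact: cpolymx_sum | exact: cpolymx_cst].
(* The matrix equation that the effects sum to 1 becomes the vanishing of one real polynomial, the
   squared Hilbert-Schmidt norm of [D x]. *)
have [g pg gE] : exists2 g, polyfun g & forall x,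
    creal_val (g x) = \tr (adjmx (D x) *m D x).
  apply: cpolyfun_real.
    by move=> x; apply/ger0_real/mxtrace_psd_ge0/psdmx_gram.
  by apply/cpolyfun_tr/cpolymxM => //; exact: cpolymx_adj.
have g0P x : g x = 0 <-> \sum_i effect x i = 1%:M.
  split=> [gx0|ex1].
    apply/eqP; rewrite -subr_eq0; apply/eqP/mxtrace_gram_eq0.
    by rewrite -[LHS]gE gx0.
  by apply: val_inj; rewrite /= gE /D ex1 subrr mulmx0 mxtrace0.
have [h ph hE] : exists2 h, polyfun h & forall x,
    creal_val (h x) = - succ_prob rho eta (effect x).
  apply: cpolyfun_real => [x|]; first by rewrite rpredN ger0_real ?succ_prob_ge0.
  apply: (@eq_cpolyfun _ (fun x => -1 * succ_prob rho eta (effect x))).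
    by move=> x; rewrite mulN1r.
  apply: cpolyfunM; first exact: cpolyfun_cst.
  apply: cpolyfun_sum => i; apply: cpolyfunM; first exact: cpolyfun_cst.
  by apply/cpolyfun_tr/cpolymxM => //; exact: cpolymx_cst.
(* Taking square roots of the effects shows that every POVM is reached, so the minimum of [h] is
   taken over all of them. *)
have surj M : povm M -> exists2 x, g x = 0 & effect x =1 M.
  move=> [pM M1]; have [x xE] := effect_root_surj (fun i => sqrtmx (M i)).
  have eM i : effect x i = M i.
    by have [[hS _] SS] := sqrtmxP (pM i); rewrite /effect xE hS.
  by exists x => //; apply/g0P; rewrite -M1; exact: eq_bigr.
have povm_effect x : g x = 0 -> povm (effect x) by move=> /g0P.
pose b' : R := in_creal (ger0_real eta_sum_ge0).
have [|||x gx0 maxx] := @polyfun_attains_min R N g h 1 b' pg ph.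
- by have [x gx _] := surj _ (povm_point (Ordinal n_gt0)); exists x.
- by move=> x i /g0P /effect_root_le1.
- move=> x /povm_effect px.
  have -> : (`|h x| <= b') = (`|creal_val (h x)| <= \sum_i eta i) by [].
  rewrite hE normrN ger0_norm ?succ_prob_ge0//; exact: succ_prob_le.
exists (effect x); first exact: povm_effect.
move=> M /surj[y /maxx le_hxy eM].
have -> : succ_prob rho eta M = succ_prob rho eta (effect y).
  by apply: eq_bigr => i _; rewrite eM.
by rewrite -lerN2 -!hE.
Qed.

End OptimalPovm.

(** * Error probability and coherence compared *)

Theorem theorem4 (C : numClosedFieldType) (n m : nat)
  (rho : 'I_n -> 'M[C]_m) (eta : 'I_n -> C) :
  (forall i, density (rho i)) ->
  (forall i, 0 < eta i) -> \sum_(i < n) eta i = 1 ->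
  exists pE cF : C,
    is_PoptE rho eta pE /\ is_CaF (qsd_state rho eta) cF /\ pE <= cF /\
    (states_lin_indep rho -> pE = cF).
Proof.
move=> rho_density eta_gt0 eta1.
have eta_ge0 i : 0 <= eta i by exact: ltW.
have n_gt0 : (0 < n)%N.
  case: n rho eta rho_density eta_gt0 eta1 {eta_ge0} => // rho eta _ _ /eqP.
  by rewrite big_ord0 eq_sym oner_eq0.
have [M pM maxM] := povm_optimal rho_density eta_ge0 n_gt0.
(* Always guessing [i0] succeeds with probability eta_i0 > 0, and the optimum is no worse. *)
have succ_gt0 : 0 < succ_prob rho eta M.
  pose i0 := Ordinal n_gt0.
  have pI := povm_point C m i0.
  apply: lt_le_trans (maxM _ pI); rewrite /succ_prob (bigD1 i0)//= big1 => [|i ii0].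
    by rewrite ?eqxx mul1mx (rho_density i0).2 mulr1 addr0.
  by rewrite (negPf ii0) mul0mx mxtrace0 mulr0.
have bound sigma : partial_incoherent sigma ->
    fidelity (qsd_state rho eta) sigma ^+ 2 <= succ_prob rho eta M.
  move=> /(fidelity_le_succ_prob rho_density eta_ge0)[M' pM' /le_trans].
  by apply; exact: maxM.
have [sigma inc_sigma le_sigma] := succ_prob_le_fidelity rho_density eta_ge0 pM succ_gt0.
exists (1 - succ_prob rho eta M), (1 - succ_prob rho eta M); split; last split.
- split; first by exists M.
  by move=> M' /maxM; rewrite opprB addrC subrK.
- split; last by move=> sigma' /bound; rewrite lerD2l lerN2.
  exists sigma; split=> //; congr (1 - _); apply: le_anti.
  by rewrite le_sigma bound.
- by [].
Qed.
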